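(* For arbitrarily large $q$ (i.e. for every integer $N$ there is some $q\ge N$) there exist a planar graph $G$, a dominating set $D$ of $G$ with $|D|=q$, and an owner assignment $m:V(G)\to D$ such that $$W=4|D|-12,\qquad |A|=|D|-6,$$ and moreover $D$ is a minimum dominating set of $G$. Consequently, the coefficient one of $|D|$ in the bound $|A|\le(|D|-3)^+$ cannot be replaced by a smaller constant, even when $D$ is minimum: for no constant $c<1$ does $|A|\le(c|D|-3)^+$ hold for all planar graphs $G$, all minimum dominating sets $D$ of $G$ and all owner assignments $m$.
   Context: All graphs are finite, simple and undirected. For $z\in\mathbb R$, $z^+=\max\{z,0\}$. $N(v)$ is the open neighborhood of $v$. Let $D$ be a dominating set of $G$ (every vertex is in $D$ or has a neighbor in $D$). An owner assignment is a map $m:V(G)\to D$ such that $m(d)=d$ for every $d\in D$, and $xm(x)\in E(G)$ for every $x\notin D$. For $d\in D$ the owner block of $d$ is $B_d=m^{-1}(d)$. For $x\in V(G)\setminus D$ set $$k_x=\bigl|\{c\in D\setminus\{m(x)\}:N(x)\cap B_c\neq\varnothing\}\bigr|.$$ Further set $W=\sum_{x\in V(G)\setminus D}(k_x-2)^+$ and $A=\{x\in V(G)\setminus D:k_x\ge 6\}$. *)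

(* Defs.v *)
From HB Require Import structures.
From mathcomp Require Import all_boot all_order all_algebra.
From mathcomp Require Import all_classical all_reals all_analysis.
Set Implicit Arguments.
Unset Strict Implicit.
Unset Printing Implicit Defensive.
Import Order.TTheory GRing.Theory Num.Theory.
Import numFieldNormedType.Exports.
Local Open Scope classical_set_scope.
Local Open Scope ring_scope.

Record sgraph := SGraph {
  vertex :> finType;
  adj : rel vertex;
  adj_sym : symmetric adj;
  adj_irrefl : irreflexive adj }.
Arguments adj {s} u v : rename.

(* A plane drawing of G: vertices are distinct points of R^2, and every edge   *)
(* uv is a simple arc, parametrized from pt u to pt v, whose interior contains *)
(* no vertex and no point of any other edge. The two orientations of an edge   *)
(* parametrize the same arc.                                                   *)
Record plane_drawing (R : realType) (G : sgraph)
    (pt : G -> R * R) (arc : G -> G -> R -> R * R) : Prop := PlaneDrawing {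
  drawing_pt_inj : injective pt;
  drawing_arc_continuous : forall u v, adj u v ->
    {within `[0 : R, 1]%classic, continuous (arc u v)};
  drawing_arc_inj : forall u v, adj u v ->
    {in `[0 : R, 1] &, injective (arc u v)};
  drawing_arc_ends : forall u v, adj u v ->
    arc u v 0 = pt u /\ arc u v 1 = pt v;
  drawing_arc_rev : forall u v, adj u v ->
    {in `[0 : R, 1], forall t, arc v u t = arc u v (1 - t)};
  drawing_arc_vertex : forall u v w, adj u v ->
    {in `]0 : R, 1[, forall t, arc u v t <> pt w};
  drawing_arc_disjoint : forall u v x y, adj u v -> adj x y ->
    [set u; v]%SET != [set x; y]%SET ->
    {in `]0 : R, 1[ & `[0 : R, 1], forall t s, arc u v t <> arc x y s} }.

Definition planar (R : realType) (G : sgraph) : Prop :=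
  exists (pt : G -> R * R) (arc : G -> G -> R -> R * R), plane_drawing pt arc.

Definition pospart (R : realType) (z : R) : R := Num.max z 0.

Section Domination.
Variable G : sgraph.
Implicit Types (D : {set G}) (m : G -> G) (x d : G).

Definition nbhd x : {set G} := [set y | adj x y]%SET.

Definition dominating D : Prop :=
  forall x, x \in D \/ exists2 d, d \in D & adj x d.

Definition minimum_dominating D : Prop :=
  dominating D /\ forall D', dominating D' -> (#|D| <= #|D'|)%N.

(* A map V(G) -> D is encoded as a self-map of V(G) with values in D. *)
Record owner_assignment D m : Prop := OwnerAssignment {
  owner_in : forall x, m x \in D;
  owner_id : forall d, d \in D -> m d = d;
  owner_adj : forall x, x \notin D -> adj x (m x) }.

Definition block m d : {set G} := [set x | m x == d]%SET.

Definition k_ D m x : nat :=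
  #|[set c in D :\ m x | nbhd x :&: block m c != finset.set0]%SET|.

Definition W_ (R : realType) D m : R :=
  \sum_(x in ~: D) pospart ((k_ D m x)%:R - 2 : R).

Definition A_ D m : {set G} := [set x in ~: D | (6 <= k_ D m x)%N]%SET.

End Domination.

(* Main.v *)
Require Import Defs.
From HB Require Import structures.
From mathcomp Require Import all_boot all_order all_algebra.
From mathcomp Require Import all_classical all_reals all_analysis.
From mathcomp Require Import ring lra zify.
Import Order.TTheory GRing.Theory Num.Theory.
Import numFieldNormedType.Exports.
Local Open Scope ring_scope.

(** In a corona (a graph [H] with one pendant edge attached at each vertex) the
    pendants form a minimum dominating set, and the [k]-value of a vertex of [H]
    is its degree in [H]. For a triangulation [H] on [q] vertices, all of degree
    at least 2, this gives [W = 2 (3 q - 6) - 2 q = 4 q - 12]. Take for [H] a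
    stack of nested triangles, consecutive ones joined as in an octahedron: the
    6 vertices of the innermost and outermost triangles have degree 4, the
    others degree 6.

    Planarity of the straight-line drawing is certified by a function on the
    plane that reads off from a point the vertex or edge it lies on. *)

(** * Straight-line drawings and their certificates *)

Definition segment {R : realType} (p q : R * R) (t : R) : R * R :=
  (p.1 + t * (q.1 - p.1), p.2 + t * (q.2 - p.2)).

Lemma segment0 (R : realType) (p q : R * R) : segment p q 0 = p.
Proof. by case: p => x y; rewrite /segment !mul0r !addr0. Qed.

Lemma segment_rev (R : realType) (p q : R * R) (t : R) :
  segment q p t = segment p q (1 - t).
Proof. by rewrite /segment; congr pair; ring. Qed.

Lemma segment1 (R : realType) (p q : R * R) : segment p q 1 = q.
Proof. by rewrite segment_rev subrr segment0. Qed.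

Lemma continuous_segment (R : realType) (p q : R * R) :
  continuous (segment p q).
Proof.
have affine (a b : R) : continuous (fun t : R => a + t * b).
  move=> t; apply: cvgD; first exact: cvg_cst.
  by apply: cvgM; [exact: cvg_id | exact: cvg_cst].
by move=> t; exact: cvg_pair (affine _ _ t) (affine _ _ t).
Qed.

Lemma segment_inj (R : realType) (p q : R * R) :
  p <> q -> injective (segment p q).
Proof.
case: p q => [x y] [x' y'] neq s t [] /addrI hx /addrI hy.
have [ex|nx] := eqVneq (x' - x) 0; last exact: (mulIf nx).
have [ey|ny] := eqVneq (y' - y) 0; last exact: (mulIf ny).
by case: neq; rewrite (subr0_eq ex) (subr0_eq ey).
Qed.

(** A point common to two pieces of the drawing would have two values under [cell]. Vertices give
    singletons, edges give two-element sets, and distinct edges give distinct sets. *)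
Lemma planar_of_cells (R : realType) (G : sgraph) (pt : G -> R * R)
    (cell : R * R -> {set G}) :
  (forall u, cell (pt u) = [set u]%SET) ->
  (forall u v, adj u v ->
     {in `]0 : R, 1[, forall t, cell (segment (pt u) (pt v) t) = [set u; v]%SET}) ->
  planar R G.
Proof.
move=> cell_pt cell_seg.
have pt_inj : injective pt.
  by move=> u v /(congr1 cell); rewrite !cell_pt => /finset.set1_inj.
have neq (u v : G) : adj u v -> u != v.
  by apply: contraTneq => ->; rewrite adj_irrefl.
have cell2 u v w : adj u v -> [set u; v]%SET <> [set w]%SET :> {set G}.
  by move=> /neq uv /(congr1 (fun A => #|pred_of_set A|)); rewrite cards2 uv cards1.
exists pt, (fun u v => segment (pt u) (pt v)); split=> //.
- by move=> u v _; apply: continuous_subspaceT; exact: continuous_segment.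
- move=> u v /neq /eqP uv s t _ _; apply: segment_inj.
  by move=> /pt_inj.
- by move=> u v _; rewrite segment0 segment1.
- by move=> u v _ t _; exact: segment_rev.
- move=> u v w uv t t01 /(congr1 cell).
  by rewrite (cell_seg _ _ uv) // cell_pt; exact: cell2.
move=> u v x y uv xy neq_e t s t01 s01 /(congr1 cell).
rewrite (cell_seg _ _ uv) //.
have [->|s0] := eqVneq s 0; first by rewrite segment0 cell_pt; exact: cell2.
have [->|s1] := eqVneq s 1; first by rewrite segment1 cell_pt; exact: cell2.
rewrite (cell_seg _ _ xy) ?in_itv /=; first exact/eqP.
by move: s01; rewrite in_itv /= !lt_neqAle s1 (eq_sym 0) s0.
Qed.

(** * Coronas: domination and $k$-values *)

Section Corona.
Variable H : sgraph.

Definition corona_adj : rel (H * bool) := fun x y =>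
  if x.2 then ~~ y.2 && (x.1 == y.1)
  else if y.2 then x.1 == y.1 else adj x.1 y.1.

Lemma corona_adj_sym : symmetric corona_adj.
Proof.
by case=> [x []] [y []]; rewrite /corona_adj //= 1?eq_sym // adj_sym.
Qed.

Lemma corona_adj_irrefl : irreflexive corona_adj.
Proof. by case=> [x []]; rewrite /corona_adj //= adj_irrefl. Qed.

Definition corona : sgraph := SGraph corona_adj_sym corona_adj_irrefl.

Definition pendants : {set corona} := [set x | x.2]%SET.

Definition pendant_of (x : corona) : corona := (x.1, true).

Lemma card_pendants : #|pendants| = #|H|.
Proof.
rewrite -[RHS](card_imset xpredT (f := fun x : H => (x, true) : corona)).
  apply: eq_card => -[x b]; rewrite inE /=.
  apply/idP/imsetP => [->|[y _ [_ ->]]] //; by exists x.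
by move=> x y [].
Qed.

Lemma pendants_owner : owner_assignment pendants pendant_of.
Proof.
split=> [x|[x []]|[x []]]; rewrite ?inE //= => _.
by rewrite /adj /= /corona_adj /=.
Qed.

Lemma pendants_dominating : dominating pendants.
Proof.
by move=> [x []]; [left; rewrite inE | right; exists (x, true);
  rewrite ?inE //= /adj /= /corona_adj /=].
Qed.

(* The closed neighbourhoods of the pendants are pairwise disjoint, and every
   dominating set meets each of them. *)
Lemma pendants_minimum : minimum_dominating pendants.
Proof.
split=> [|D' dom]; first exact: pendants_dominating.
apply: leq_trans (leq_imset_card pendant_of D'); apply: subset_leq_card.
apply/fintype.subsetP => -[x []]; rewrite inE // => _; apply/imsetP.
have [xD|[[y b] yD]] := dom (x, true); first by exists (x, true).
by rewrite /adj /= /corona_adj /= => /andP[_ /eqP ->]; exists (y, b).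
Qed.

(** The block of [(y, true)] is [y] together with its pendant. For [y] other than [x], the vertex
    [(x, false)] meets it exactly when [y] is adjacent to [x] in [H]; its own pendant lies in the
    excluded block. *)
Lemma k_corona (x : H) : k_ pendants pendant_of ((x, false) : corona) = #|nbhd x|.
Proof.
rewrite -(card_imset _ (f := fun y : H => (y, true) : corona)); last first.
  by move=> y z [].
apply: eq_card => -[y b]; rewrite !inE /=; apply/idP/imsetP.
  case/andP=> /andP[neq bT] /set0Pn[[z c]].
  move: neq; rewrite {}bT !inE /= !xpair_eqE /= !andbT => neq.
  rewrite /adj /= /corona_adj /= => /andP[+ /eqP eyz]; rewrite -{}eyz in neq *.
  by case: c => [|xz]; [rewrite eq_sym (negbTE neq) | exists z; rewrite ?inE].
case=> z; rewrite inE => xz [-> ->]; rewrite andbT; apply/andP; split.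
  rewrite xpair_eqE andbT; apply: contraTneq xz => ->.
  by rewrite adj_irrefl.
by apply/set0Pn; exists (z, false); rewrite !inE /= /pendant_of /= eqxx andbT.
Qed.

Lemma nonpendant_sum (R : nmodType) (F : corona -> R) :
  \sum_(x in ~: pendants) F x = \sum_(x : H) F (x, false).
Proof.
rewrite (reindex_onto (fun x : H => (x, false) : corona) fst) /=; last first.
  by case=> x []; rewrite ?inE.
by apply: eq_bigl => x; rewrite !inE eqxx.
Qed.

Lemma W_corona (R : realType) :
  W_ R pendants pendant_of = \sum_(x : H) pospart (#|nbhd x|%:R - 2).
Proof.
by rewrite /W_ nonpendant_sum; apply: eq_bigr => x _; rewrite k_corona.
Qed.

Lemma card_A_corona :
  #|A_ pendants pendant_of| = #|[set x : H | (6 <= #|nbhd x|)%N]|.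
Proof.
rewrite -(card_imset _ (f := fun y : H => (y, false) : corona)); last first.
  by move=> y z [].
apply: eq_card => -[x b]; rewrite !inE /=; apply/andP/imsetP => [[]|].
  by case: b => // _; rewrite k_corona; exists x; rewrite ?inE.
by case=> y; rewrite inE => dy [-> ->]; rewrite k_corona.
Qed.

End Corona.

(** * The tower of nested triangles and its degrees *)

Section TriangleTower.
Variable n : nat.

Definition tower_vertex : Type := ('I_n.+1 * 'I_3)%type.
HB.instance Definition _ := Finite.on tower_vertex.

(** One orientation of each edge: cyclically within a triangle, or outward to the next triangle, at
    the same corner (radial) or the following one (diagonal). *)
Definition tower_link (u v : tower_vertex) : bool :=
  (v.2 == ordS u.2) && ((v.1 == u.1 :> nat) || (v.1 == u.1.+1 :> nat))
  || (v.2 == u.2) && (v.1 == u.1.+1 :> nat).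

Definition tower_adj (u v : tower_vertex) := tower_link u v || tower_link v u.

Lemma tower_adj_sym : symmetric tower_adj.
Proof. by move=> u v; rewrite /tower_adj orbC. Qed.

Lemma tower_adj_irrefl : irreflexive tower_adj.
Proof.
by move=> [i [[|[|[|j]]] jlt]]; rewrite /tower_adj /tower_link /= -?val_eqE /=; lia.
Qed.

Definition tower : sgraph := SGraph tower_adj_sym tower_adj_irrefl.

Lemma card_tower : #|tower| = (3 * n.+1)%N.
Proof. by rewrite card_prod !card_ord mulnC. Qed.

Lemma card_nbhd_tower (i : 'I_n.+1) (j : 'I_3) :
  #|nbhd ((i, j) : tower)| = (2 + (i < n).*2 + (0 < i).*2)%N.
Proof.
(* All neighbours: two in the same triangle, two in the next one out and two in the next one in,
   when these exist. *)
pose s := [:: (i, ordS j); (i, ord_pred j)]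
  ++ (if (i < n)%N then [:: (inord i.+1, j); (inord i.+1, ordS j)] else [::])
  ++ (if (0 < i)%N then [:: (inord i.-1, j); (inord i.-1, ord_pred j)] else [::])
  : seq tower_vertex.
have ilt := ltn_ord i.
have up : (i < n)%N -> (inord i.+1 : 'I_n.+1) = i.+1 :> nat.
  by move=> ?; rewrite inordK; lia.
have down : (inord i.-1 : 'I_n.+1) = i.-1 :> nat by rewrite inordK; lia.
have us : uniq s.
  rewrite /s; move: up; case: (ltnP i n) => hn up; case: (ltnP 0 i) => h0;
  case: j @s => [[|[|[|j]]] jlt] //= ;
  by rewrite !inE !xpair_eqE -!val_eqE /= ?down ?up //; lia.
transitivity (size s); last first.
  by rewrite /s !size_cat; case: ltnP => _; case: ltnP => _.
rewrite -(card_uniqP us); apply: eq_card => -[i' j'].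
rewrite inE /adj /= /tower_adj /tower_link /= /s.
have i'lt := ltn_ord i'.
move: up; case: (ltnP i n) => hn up; case: (ltnP 0 i) => h0;
  case: j {s us} => [[|[|[|j]]] jlt] //=; case: j' => [[|[|[|j']]] j'lt] //=;
  rewrite !inE !xpair_eqE -!val_eqE /= ?down ?up //; lia.
Qed.

End TriangleTower.

Arguments tower_link {n} u v.

(** * The plane drawing of the corona of the tower *)

Section Drawing.
Variables (R : realType) (n : nat).
Implicit Types (i : 'I_n.+1) (j : 'I_3) (z : R * R) (s t : R).

(* The rays through (1,0), (0,1), (-1,-1) cut the plane into three sectors;
   [place j] takes coordinates along the two rays bounding the [j]-th one. *)
Definition place j z : R * R :=
  match val j with
  | 0 => z
  | 1 => (- z.2, z.1 - z.2)
  | _ => (z.2 - z.1, - z.1)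
  end.

(** Sectors are half-open: each contains its first bounding ray, where the second coordinate is 0,
    but not its second one. The origin, which falls into the last case, is off the drawing. *)
Definition locate z : 'I_3 * (R * R) :=
  if (0 < z.1) && (0 <= z.2) then (0, z)
  else if (z.1 <= 0) && (z.1 < z.2) then (1, (z.2 - z.1, - z.1))
  else (1 + 1, (- z.2, z.1 - z.2)).

Lemma placeK j s t : 0 < s -> 0 <= t -> locate (place j (s, t)) = (j, (s, t)).
Proof.
move=> s0 t0; case: j => [[|[|[|j]]] jlt] //; rewrite /place /locate /=.
- by rewrite s0 t0; congr pair; apply: val_inj.
- case: ifP => [?|_]; first by exfalso; lra.
  case: ifP => [_|?]; last by exfalso; lra.
  by congr (_, (_, _)); [apply: val_inj | ring | ring].
- case: ifP => [?|_]; first by exfalso; lra.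
  case: ifP => [?|_]; first by exfalso; lra.
  by congr (_, (_, _)); [apply: val_inj | ring | ring].
Qed.

Lemma place_segment j z z' t :
  segment (place j z) (place j z') t = place j (segment z z' t).
Proof.
by case: j => [[|[|[|j]]] jlt] //; rewrite /place /segment /=; congr pair; ring.
Qed.

(** Consecutive sectors share a ray, so an edge from corner [j] to corner [ordS j] can be treated
    inside sector [j] alone. *)
Lemma place_ordS j s : place (ordS j) (s, 0) = place j (0, s).
Proof.
by case: j => [[|[|[|j]]] jlt] //; rewrite /place /=; congr pair; ring.
Qed.

(** The pendant leaves its vertex between the radial and the diagonal direction, and stays below the
    next level. *)
Definition tower_point (x : corona (tower n)) : R * R :=
  let p := (x.1.1).+1%:R in
  place x.1.2 (if x.2 then (p + 4^-1, 4^-1) else (p, 0)).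

(* The points of the drawing between levels [q - 1] and [q] lie in the strip
   [q <= s + t < q + 1], since level [i] sits at distance [i + 1] on the rays.
   Only the values on the drawing matter: elsewhere the result is arbitrary. *)
Definition tower_cell z : {set corona (tower n)} :=
  let: (j, (s, t)) := locate z in
  let q := Num.truncn (s + t) in
  let x (k : nat) (j' : 'I_3) : corona (tower n) := ((inord k, j'), false) in
  let y : corona (tower n) := ((inord q.-1, j), true) in
  if t == 0 then
    if s == q%:R then [set x q.-1 j]%SET else [set x q.-1 j; x q j]%SET
  else if s + t == q%:R then [set x q.-1 j; x q.-1 (ordS j)]%SET
  else if q.+1%:R * s + q%:R * t == q%:R * q.+1%:R then
    [set x q.-1 j; x q (ordS j)]%SET
  else if s == q%:R + 4^-1 then [set y]%SET else [set x q.-1 j; y]%SET.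

(** On this strip the truncation is the constant [i.+1], so only polynomial tests remain. The first
    three test equations describe the radial line, the triangle side, and the diagonal through
    [(p, 0)] and [(0, p + 1)]. *)
Lemma tower_cell_place i j s t : 0 < s -> 0 <= t ->
  i.+1%:R <= s + t < i.+2%:R ->
  tower_cell (place j (s, t)) =
  let p := i.+1%:R in
  let x (k : nat) (j' : 'I_3) : corona (tower n) := ((inord k, j'), false) in
  let y : corona (tower n) := ((i, j), true) in
  if t == 0 then
    if s == p then [set x i j]%SET else [set x i j; x i.+1 j]%SET
  else if s + t == p then [set x i j; x i (ordS j)]%SET
  else if (p + 1) * s + p * t == p * (p + 1) then
    [set x i j; x i.+1 (ordS j)]%SET
  else if s == p + 4^-1 then [set y]%SET else [set x i j; y]%SET.
Proof.
move=> s0 t0 st; rewrite /tower_cell placeK // (truncn_def st) /=.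
by rewrite inord_val [i.+2%:R]mulrS [1 + _]addrC.
Qed.

Lemma tower_cell_point (x : corona (tower n)) :
  tower_cell (tower_point x) = [set x]%SET.
Proof.
case: x => [[i j] b]; rewrite /tower_point /=.
have p1 : 1 <= i.+1%:R :> R by rewrite ler1n.
have p2 : i.+2%:R = i.+1%:R + 1 :> R by rewrite mulrSr.
case: b.
  rewrite (@tower_cell_place i) ?p2; [|lra|lra|lra].
  rewrite /= eqxx !ifF //; apply/negbTE/eqP; nra.
rewrite (@tower_cell_place i) ?p2; [|lra|lra|lra].
by rewrite /= !eqxx inord_val.
Qed.

Lemma tower_cell_pendant i j t : t \in `]0, 1[ ->
  tower_cell (segment (tower_point ((i, j), false)) (tower_point ((i, j), true)) t)
  = [set ((i, j), false); ((i, j), true)]%SET.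
Proof.
rewrite in_itv /= => /andP[t0 t1]; rewrite /tower_point place_segment /segment /=.
have p1 : 1 <= i.+1%:R :> R by rewrite ler1n.
have p2 : i.+2%:R = i.+1%:R + 1 :> R by rewrite mulrSr.
rewrite (@tower_cell_place i) ?p2; [|lra|lra|lra].
by rewrite /= inord_val !ifF //; apply/negbTE/eqP; nra.
Qed.

Lemma tower_cell_level i j t : t \in `]0, 1[ ->
  tower_cell (segment (tower_point ((i, j), false))
                      (tower_point ((i, ordS j), false)) t)
  = [set ((i, j), false); ((i, ordS j), false)]%SET.
Proof.
rewrite in_itv /= => /andP[t0 t1].
rewrite /tower_point /= place_ordS place_segment /segment /=.
have p1 : 1 <= i.+1%:R :> R by rewrite ler1n.
have p2 : i.+2%:R = i.+1%:R + 1 :> R by rewrite mulrSr.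
rewrite (@tower_cell_place i) ?p2; [|nra|nra|lra].
rewrite /= inord_val ifF; last by apply/negbTE/eqP; nra.
by rewrite ifT //; apply/eqP; ring.
Qed.

Lemma tower_cell_radial i i' j t : i' = i.+1 :> nat -> t \in `]0, 1[ ->
  tower_cell (segment (tower_point ((i, j), false))
                      (tower_point ((i', j), false)) t)
  = [set ((i, j), false); ((i', j), false)]%SET.
Proof.
move=> ii' /[!in_itv] /= /andP[t0 t1].
have xi' : inord i.+1 = i' by rewrite -ii' inord_val.
rewrite /tower_point /= ii' place_segment /segment /=.
have p1 : 1 <= i.+1%:R :> R by rewrite ler1n.
have p2 : i.+2%:R = i.+1%:R + 1 :> R by rewrite mulrSr.
rewrite (@tower_cell_place i) ?p2; [|lra|lra|lra].
rewrite /= inord_val xi' ifT; last by apply/eqP; ring.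
by rewrite ifF //; apply/negbTE/eqP; lra.
Qed.

Lemma tower_cell_diagonal i i' j t : i' = i.+1 :> nat -> t \in `]0, 1[ ->
  tower_cell (segment (tower_point ((i, j), false))
                      (tower_point ((i', ordS j), false)) t)
  = [set ((i, j), false); ((i', ordS j), false)]%SET.
Proof.
move=> ii' /[!in_itv] /= /andP[t0 t1].
have xi' : inord i.+1 = i' by rewrite -ii' inord_val.
rewrite /tower_point /= ii' place_ordS place_segment /segment /=.
have p1 : 1 <= i.+1%:R :> R by rewrite ler1n.
have p2 : i.+2%:R = i.+1%:R + 1 :> R by rewrite mulrSr.
rewrite (@tower_cell_place i) ?p2; [|nra|nra|lra].
rewrite /= inord_val xi' ifF; last by apply/negbTE/eqP; nra.
rewrite ifF; last by apply/negbTE/eqP; nra.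
by rewrite ifT //; apply/eqP; ring.
Qed.

Lemma tower_cell_link (u v : tower n) t : tower_link u v -> t \in `]0, 1[ ->
  tower_cell (segment (tower_point (u, false)) (tower_point (v, false)) t)
  = [set (u, false); (v, false)]%SET.
Proof.
case: u v => [i j] [i' j']; rewrite /tower_link /= => /orP[] /andP[/eqP->].
  by case/orP=> /eqP ii'; [rewrite (val_inj ii'); exact: tower_cell_level
                         | exact: tower_cell_diagonal].
by move=> /eqP; exact: tower_cell_radial.
Qed.

Lemma tower_cell_segmentC (x y : corona (tower n)) :
  {in `]0 : R, 1[, forall t, tower_cell (segment (tower_point x) (tower_point y) t)
     = [set x; y]%SET} ->
  {in `]0 : R, 1[, forall t, tower_cell (segment (tower_point y) (tower_point x) t)
     = [set y; x]%SET}.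
Proof.
move=> cell_xy t /[!in_itv] /= t01; rewrite segment_rev cell_xy 1?finset.setUC //.
by rewrite in_itv /=; lra.
Qed.

Lemma planar_corona_tower : planar R (corona (tower n)).
Proof.
apply: (planar_of_cells _ _ _ _ tower_cell_point).
move=> [u b] [v c]; rewrite /adj /= /corona_adj /=.
case: b => [/andP[]|].
  case: c => // _ /eqP <-; apply: tower_cell_segmentC => t.
  by case: u => i j; exact: tower_cell_pendant.
case: c => [/eqP <- t|/orP[uv t|vu]].
- by case: u => i j; exact: tower_cell_pendant.
- exact: tower_cell_link.
- by apply: tower_cell_segmentC => t; exact: tower_cell_link.
Qed.

End Drawing.

(** * Counting in the tower, and the conclusion *)

Lemma W_corona_tower (R : realType) (n : nat) :
  W_ R (pendants (tower n)) (@pendant_of (tower n)) =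
  4 * #|pendants (tower n)|%:R - 12.
Proof.
rewrite W_corona card_pendants card_tower.
rewrite (eq_bigr (fun x => ((val x.1 < n).*2 + (0 < val x.1).*2)%N%:R)); last first.
  move=> [i j] _; rewrite card_nbhd_tower -addnA natrD addrAC subrr add0r.
  by rewrite /pospart max_l.
rewrite -natr_sum -(pair_bigA _ (fun (i : 'I_n.+1) (j : 'I_3) =>
  ((val i < n).*2 + (0 < val i).*2)%N)) /=.
under eq_bigr do rewrite sum_nat_const card_ord.
(* The outermost level has no outer neighbours and the innermost no inner ones; splitting these off
   leaves [n] levels in each sum. *)
rewrite -big_distrr /= big_split /= big_ord_recr /= ltnn addn0.
rewrite [X in (_ + X)%N]big_ord_recl /= add0n.
under eq_bigr do rewrite ltn_ord.
rewrite !sum_nat_const card_ord (_ : true.*2 = 2%N) //.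
by rewrite !natrM natrD !natrM (mulrSr 1 n); ring.
Qed.

(** Degree 6 means having a triangle on both sides. With at least two triangles, the innermost and
    outermost are distinct, and their 6 vertices are the ones left out. *)
Lemma card_A_corona_tower (n : nat) :
  (#|A_ (pendants (tower n.+1)) (@pendant_of (tower n.+1))| + 6)%N =
  #|pendants (tower n.+1)|.
Proof.
rewrite card_pendants card_tower (_ : 3 * n.+2 = 3 * n + 6)%N; last by lia.
congr (_ + 6)%N.
rewrite card_A_corona -sum1_card.
rewrite (eq_bigl (fun x : tower n.+1 => (0 < val x.1 < n.+1)%N && true)); last first.
  by move=> [i j]; rewrite inE card_nbhd_tower /= -!muln2; lia.
rewrite -(pair_big (fun i : 'I_n.+2 => (0 < val i < n.+1)%N) xpredT (fun _ _ => 1%N)) /=.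
under eq_bigr do rewrite sum1_card card_ord.
rewrite big_mkcond big_ord_recl /= add0n big_ord_recr /= /bump /= add1n ltnn addn0.
under eq_bigr do rewrite /= add1n ltnS ltn_ord.
by rewrite sum_nat_const card_ord mulnC.
Qed.

Theorem propositionC1 (R : realType) :
  (forall N : nat, exists q : nat, (N <= q)%N /\
    exists (G : sgraph) (D : {set G}) (m : G -> G),
      [/\ planar R G, dominating D, #|D| = q & owner_assignment D m] /\
      [/\ W_ R D m = 4 * #|D|%:R - 12,
          #|A_ D m|%:R = #|D|%:R - 6 :> R
        & minimum_dominating D]) /\
  (forall c : R, c < 1 ->
    ~ (forall (G : sgraph) (D : {set G}) (m : G -> G),
         planar R G -> minimum_dominating D -> owner_assignment D m ->
         #|A_ D m|%:R <= pospart (c * #|D|%:R - 3))).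
Proof.
have card_A n :
    #|A_ (pendants (tower n.+1)) (@pendant_of (tower n.+1))|%:R =
    #|pendants (tower n.+1)|%:R - 6 :> R.
  by rewrite -card_A_corona_tower natrD addrK.
split=> [N|c c1 bound].
  exists (3 * N.+2)%N; split; first by lia.
  exists (corona (tower N.+1)), (pendants (tower N.+1)), (@pendant_of (tower N.+1)).
  split; split=> //.
  - exact: planar_corona_tower.
  - exact: pendants_dominating.
  - by rewrite card_pendants card_tower.
  - exact: pendants_owner.
  - exact: W_corona_tower.
  - exact: pendants_minimum.
have c1' : 0 < 1 - c by rewrite subr_gt0.
(* With $q = 3(n+2)$, the inequality $q > 3/(1-c)$ amounts to $cq - 3 < q - 6$. *)
pose n := (Num.bound (3 / (1 - c))).+1.
have := bound _ _ _ (planar_corona_tower R n.+1) (pendants_minimum _) (pendants_owner _).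
rewrite card_A card_pendants card_tower /pospart leNgt => /negP; apply.
(* This makes $q - 6$ exceed the 0 in the positive part as well; the successor in the choice of [n]
   ensures it. *)
have q7 : 7 <= (3 * n.+2)%:R :> R by rewrite ler_nat; lia.
have : 3 / (1 - c) < (3 * n.+2)%:R.
  apply: lt_le_trans (archi_boundP _) _; first by rewrite divr_ge0 // ltW.
  by rewrite ler_nat; lia.
rewrite ltr_pdivrMr // gt_max => ?; lra.
Qed.
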